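(* Let $F:\mathbb{R}^d\to\mathbb{R}$ be twice continuously differentiable with $L$-Lipschitz gradient, lower bounded ($F_*:=\inf F>-\infty$), and with $\rho$-Lipschitz Hessian: $\|\nabla^2F(x)-\nabla^2F(y)\|\le\rho\|x-y\|$ for all $x,y$. Consider the simplified curvature-aware Adam iteration described in the context, with stochastic gradients satisfying $\mathbb{E}[g_k\mid\theta_k]=\nabla F(\theta_k)$, $\mathbb{E}[\|g_k-\nabla F(\theta_k)\|^2\mid\theta_k]\le\sigma^2$, $\|g_k\|_\infty\le\|g_k\|\le G$, and stepsize $\eta\le\min(1,1/L)$. Let $\tilde\nabla_k:=\nabla F(\theta_k)+\alpha_k\big(\nabla F(\theta_k)-\nabla F(\theta_{k-1})\big)$. Then for each $k$, $$\nabla F(\theta_k)-\nabla F(\theta_{k-1})=\Big(\int_0^1\nabla^2F\big(\theta_{k-1}+t(\theta_k-\theta_{k-1})\big)\,dt\Big)(\theta_k-\theta_{k-1}),$$ hence $\tilde\nabla_k=\nabla F(\theta_k)+\alpha_k\Big(\int_0^1\nabla^2F\big(\theta_{k-1}+t(\theta_k-\theta_{k-1})\big)\,dt\Big)(\theta_k-\theta_{k-1})$, and $$\big\|\tilde\nabla_k-\nabla F(\theta_k)-\alpha_k\nabla^2F(\theta_k)(\theta_k-\theta_{k-1})\big\|\le C_\alpha\rho\,\|\theta_k-\theta_{k-1}\|^2.$$ Moreover, there exist positive constants $C_1,C_2,C_3$ depending only on $L,\delta,\beta_1,G,C_\alpha,d$ such that for every $T\ge1$, $\frac{1}{T}\sum_{k=0}^{T-1}\mathbb{E}\|\nabla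 F(\theta_k)\|^2\le \frac{C_1(F(\theta_0)-F_*+G^2)}{\eta T}+C_2\eta+C_3\sigma^2$.
   Context: Simplified curvature-aware Adam iteration: given parameters $\beta_1,\beta_2\in[0,1)$, $\delta>0$, stepsize $\eta>0$, a base coefficient $\alpha_{\mathrm{base}}>0$, and stochastic gradient estimators $g_k$ of $\nabla F(\theta_k)$, the iterates are $\tilde g_k:=g_k+\alpha_k(g_k-g_{k-1})$, $m_k:=\beta_1 m_{k-1}+(1-\beta_1)\tilde g_k$, $v_k:=\beta_2 v_{k-1}+(1-\beta_2)\tilde g_k^{2}$ (coordinatewise), $\theta_{k+1}:=\theta_k-\eta\, m_k/(\sqrt{v_k}+\delta)$ (coordinatewise), with initialization $m_{-1}=0$, $v_{-1}=0$, $\theta_{-1}=\theta_0$, $\alpha_0=0$. The coefficients satisfy $|\alpha_k|\le C_\alpha:=2\alpha_{\mathrm{base}}$ for all $k$. $\|\cdot\|$ is the Euclidean norm (operator norm for matrices). *)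

(* Defs.v *)
From HB Require Import structures.
From mathcomp Require Import all_boot all_order all_algebra.
From mathcomp Require Import all_classical all_reals all_analysis.
Set Implicit Arguments. Unset Strict Implicit. Unset Printing Implicit Defensive.
Import Order.TTheory GRing.Theory Num.Theory.
Import numFieldNormedType.Exports.
Local Open Scope classical_set_scope.
Local Open Scope ring_scope.

Section Defs.
Variable R : realType.

Definition norm2 {d : nat} (v : 'rV[R]_d) : R :=
  Num.sqrt (\sum_(i < d) v ord0 i ^+ 2).

Definition mxv {d : nat} (A : 'M[R]_d) (v : 'rV[R]_d) : 'rV[R]_d :=
  \row_i \sum_(j < d) A i j * v ord0 j.

Definition opnorm {d : nat} (A : 'M[R]_d) : R :=
  sup [set norm2 (mxv A v) | v in [set v : 'rV[R]_d | norm2 v <= 1]].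

Definition grad {d : nat} (F : 'rV[R]_d -> R) (x : 'rV[R]_d) : 'rV[R]_d :=
  \row_i ('d F x (delta_mx ord0 i : 'rV[R]_d)).

Definition hess {d : nat} (F : 'rV[R]_d -> R) (x : 'rV[R]_d) : 'M[R]_d :=
  \matrix_(i, j) (('d (grad F) x (delta_mx ord0 j : 'rV[R]_d)) ord0 i).

Definition seg_hess_int {d : nat} (F : 'rV[R]_d -> R) (x y : 'rV[R]_d)
  : 'M[R]_d :=
  \matrix_(i, j) (\int[lebesgue_measure]_(t in `[0%R, 1%R])
                    (hess F (x + t *: (y - x)) i j)).

Definition Finf {d : nat} (F : 'rV[R]_d -> R) : R := inf (range F).

Section Adam.
Variables (d : nat) (beta1 beta2 delta eta : R) (theta0 : 'rV[R]_d).
Variables (g : nat -> 'rV[R]_d) (alpha : nat -> R).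

(* g_{-1} := 0 ; irrelevant since alpha_0 = 0 *)
Definition gprev (k : nat) : 'rV[R]_d := if k is k'.+1 then g k' else 0.

Definition gtilde (k : nat) : 'rV[R]_d := g k + alpha k *: (g k - gprev k).

(* adam_state k = (theta_k, m_{k-1}, v_{k-1}) *)
Fixpoint adam_state (k : nat) : 'rV[R]_d * 'rV[R]_d * 'rV[R]_d :=
  match k with
  | 0 => (theta0, 0, 0)
  | k'.+1 =>
      let '(th, m, v) := adam_state k' in
      let gt := gtilde k' in
      let m' := beta1 *: m + (1 - beta1) *: gt in
      let v' := beta2 *: v + (1 - beta2) *: map_mx (fun x => x ^+ 2) gt in
      (th - eta *: \row_i (m' ord0 i / (Num.sqrt (v' ord0 i) + delta)), m', v')
  end.

Definition adam_theta (k : nat) : 'rV[R]_d := (adam_state k).1.1.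

Definition adam_theta_prev (k : nat) : 'rV[R]_d :=
  if k is k'.+1 then adam_theta k' else adam_theta 0.
End Adam.

Section Cond.
Context {dT : measure_display} {T : measurableType dT}.

Definition sigma_of {d : nat} (X : T -> 'rV[R]_d) : set (set T) :=
  <<s \bigcup_(i in [set: 'I_d])
        preimage_set_system setT (fun w => X w ord0 i) measurable >>.

(* E[f | S] = h  (defining property of conditional expectation, h S-meas.) *)
Definition condexp_eq (P : probability T R) (S : set (set T)) (f h : T -> R)
  : Prop :=
  forall A, S A -> (\int[P]_(w in A) (f w)%:E = \int[P]_(w in A) (h w)%:E)%E.

Definition condexp_le (P : probability T R) (S : set (set T)) (f : T -> R)
  (c : R) : Prop :=
  forall A, S A -> (\int[P]_(w in A) (f w)%:E <= c%:E * P A)%E.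
End Cond.

End Defs.

(* Main.v *)
Require Import Defs.
From HB Require Import structures.
From mathcomp Require Import all_boot all_order all_algebra.
From mathcomp Require Import ring lra.
From mathcomp Require Import all_classical all_reals all_analysis.
From mathcomp Require Import measurable_realfun.
Import Order.TTheory GRing.Theory Num.Theory.
Import numFieldNormedType.Exports.
Local Open Scope classical_set_scope.
Local Open Scope ring_scope.

(* The rate comes from a pathwise bound, integrated only at the end.  The momentum satisfies
   m_k = (1 - beta1^(k+1)) grad F(theta_k) + r_k, where
   r_k = beta1 r_(k-1) + (1 - beta1) s_k and |s_k|^2 is bounded by the squared noises at k and
   k-1 plus O(eta^2).  As sqrt(v_k) + delta lies coordinatewise between two positive constants,
   Young's inequality in the descent lemma gives
   F(theta_(k+1)) <= F(theta_k) - eta c |grad F(theta_k)|^2 + eta K |r_k|^2 + O(eta^2).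
   By convexity, adding eta times multiples of |r_(k-1)|^2 and of the last squared noise to
   F(theta_k) yields a potential that telescopes.  The correlation of v_k with g_k is harmless
   because the noise only has to be controlled up to a multiple of sigma^2. *)

(** * Euclidean geometry *)

Definition dot {R : realType} {d : nat} (u v : 'rV[R]_d) : R :=
  \sum_(i < d) u ord0 i * v ord0 i.

Definition nsq {R : realType} {d : nat} (v : 'rV[R]_d) : R :=
  \sum_(i < d) v ord0 i ^+ 2.

Section Euclid.
Context {R : realType} {d : nat}.
Implicit Types (u v w x y z : 'rV[R]_d) (A : 'M[R]_d).

Lemma nsq_ge0 v : 0 <= nsq v.
Proof. by apply: sumr_ge0 => i _; exact: sqr_ge0. Qed.

Lemma norm2_ge0 v : 0 <= norm2 v.
Proof. exact: sqrtr_ge0. Qed.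

Lemma sqr_norm2 v : norm2 v ^+ 2 = nsq v.
Proof. by rewrite sqr_sqrtr// nsq_ge0. Qed.

Lemma dotvv v : dot v v = nsq v.
Proof. by apply: eq_bigr => i _; rewrite expr2. Qed.

Lemma dotBr u v w : dot u (v - w) = dot u v - dot u w.
Proof.
by rewrite /dot -sumrB; apply: eq_bigr => i _; rewrite !mxE mulrBr.
Qed.

Lemma dotBl u v w : dot (u - v) w = dot u w - dot v w.
Proof.
by rewrite /dot -sumrB; apply: eq_bigr => i _; rewrite !mxE mulrBl.
Qed.

Lemma nsqZ (a : R) v : nsq (a *: v) = a ^+ 2 * nsq v.
Proof. by rewrite /nsq mulr_sumr; apply: eq_bigr => i _; rewrite mxE exprMn. Qed.

Lemma nsqN v : nsq (- v) = nsq v.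
Proof. by apply: eq_bigr => i _; rewrite mxE sqrrN. Qed.

Lemma norm2Z (a : R) v : norm2 (a *: v) = `|a| * norm2 v.
Proof.
rewrite /norm2 -[X in Num.sqrt X]/(nsq (a *: v)) nsqZ sqrtrM ?sqr_ge0//.
by rewrite sqrtr_sqr.
Qed.

Lemma nsq0 : nsq (0 : 'rV[R]_d) = 0.
Proof. by rewrite /nsq big1// => i _; rewrite mxE expr0n. Qed.

Lemma nsq_eq0 v : nsq v = 0 -> v = 0.
Proof.
move=> /eqP; rewrite psumr_eq0 => [/allP v0|i _]; last exact: sqr_ge0.
apply/rowP => i; rewrite mxE; apply/eqP.
by rewrite -(sqrf_eq0 (v ord0 i)); apply: (v0 i); rewrite mem_index_enum.
Qed.

(** The free weight [a] is tuned at each use: to the ratio of the two norms for Cauchy-Schwarz, to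
    [L] in the descent lemma. *)
Lemma dot_young (a : R) u v : 0 < a ->
  dot u v <= a / 2 * nsq v + (2 * a)^-1 * nsq u.
Proof.
move=> a0; rewrite /dot /nsq !mulr_sumr -big_split; apply: ler_sum => i _ /=.
set p := u ord0 i; set q := v ord0 i.
rewrite -subr_ge0.
suff -> : a / 2 * q ^+ 2 + (2 * a)^-1 * p ^+ 2 - p * q =
  (a * q - p) ^+ 2 / (2 * a) by rewrite divr_ge0 ?sqr_ge0 ?mulr_ge0// ltW.
by field; rewrite gt_eqF.
Qed.

(** The weights on the right sum to 1, so in the recursion for the momentum error the old error
    contracts by exactly [beta1], with no extra factor. *)
Lemma nsqD_convex (b : R) u v : 0 <= b <= 1 ->
  nsq (b *: u + (1 - b) *: v) <= b * nsq u + (1 - b) * nsq v.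
Proof.
move=> /andP[b0 b1]; rewrite /nsq !mulr_sumr -big_split; apply: ler_sum => i _.
rewrite !mxE /= -subr_ge0; set p := u ord0 i; set q := v ord0 i.
suff -> : b * p ^+ 2 + (1 - b) * q ^+ 2 - (b * p + (1 - b) * q) ^+ 2 =
  b * (1 - b) * (p - q) ^+ 2.
  by rewrite mulr_ge0 ?sqr_ge0// mulr_ge0// subr_ge0.
by ring.
Qed.

Lemma nsqD3 u v w : nsq (u + v + w) <= 3 * (nsq u + nsq v + nsq w).
Proof.
rewrite /nsq -!big_split mulr_sumr; apply: ler_sum => i _; rewrite !mxE /=.
have := sqr_ge0 (u ord0 i - v ord0 i); have := sqr_ge0 (u ord0 i - w ord0 i).
have := sqr_ge0 (v ord0 i - w ord0 i); nra.
Qed.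

(** Young's inequality with weight [norm2 u / norm2 v] is balanced, and its right side becomes the
    product of the norms. Zero vectors are set apart because of the division. *)
Lemma cauchy_schwarz u v : dot u v <= norm2 u * norm2 v.
Proof.
have [v0|v0] := eqVneq (nsq v) 0.
  have -> : dot u v = 0 by rewrite (nsq_eq0 _ v0) /dot big1// => i _; rewrite mxE mulr0.
  by rewrite mulr_ge0// norm2_ge0.
have [u0|u0] := eqVneq (nsq u) 0.
  have -> : dot u v = 0 by rewrite (nsq_eq0 _ u0) /dot big1// => i _; rewrite mxE mul0r.
  by rewrite mulr_ge0// norm2_ge0.
have pu : 0 < norm2 u by rewrite sqrtr_gt0 lt_neqAle eq_sym u0 nsq_ge0.
have pv : 0 < norm2 v by rewrite sqrtr_gt0 lt_neqAle eq_sym v0 nsq_ge0.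
apply: (le_trans (dot_young _ u v (divr_gt0 pu pv))).
rewrite -!sqr_norm2 le_eqVlt; apply/orP; left; apply/eqP; field.
by rewrite !gt_eqF.
Qed.

Lemma le_norm2 v (c : R) : 0 <= c -> nsq v <= c * norm2 v -> norm2 v <= c.
Proof.
move=> c0; rewrite -sqr_norm2 expr2.
have [->//|v0] := eqVneq (norm2 v) 0.
by rewrite ler_pM2r// lt_neqAle eq_sym v0 norm2_ge0.
Qed.

Lemma mxvE A v : mxv A v = v *m A^T.
Proof.
by apply/rowP => i; rewrite !mxE; apply: eq_bigr => j _; rewrite !mxE mulrC.
Qed.

Lemma mxvBl A B v : mxv (A - B) v = mxv A v - mxv B v.
Proof. by rewrite !mxvE linearB/= mulmxBr. Qed.

Lemma mxvZr A (a : R) v : mxv A (a *: v) = a *: mxv A v.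
Proof. by rewrite !mxvE scalemxAl. Qed.

Lemma mxv0 A : mxv A 0 = 0.
Proof. by rewrite mxvE mul0mx. Qed.

(** Cauchy-Schwarz on each row; the constant is the squared Frobenius norm of [A]. *)
Lemma nsq_mxv_le A v :
  nsq (mxv A v) <= (\sum_(i < d) nsq (row i A)) * nsq v.
Proof.
rewrite {1}/nsq mulr_suml; apply: ler_sum => i _.
have -> : mxv A v ord0 i = dot (row i A) v.
  by rewrite mxE; apply: eq_bigr => j _; rewrite mxE.
rewrite -!sqr_norm2 -exprMn -ler_sqrt ?sqr_ge0// !sqrtr_sqr.
rewrite [leRHS]ger0_norm ?mulr_ge0 ?norm2_ge0// ler_norml cauchy_schwarz andbT.
rewrite lerNl; have := cauchy_schwarz (- row i A) v.
rewrite /norm2 -!/(nsq _) nsqN; apply: le_trans.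
by rewrite /dot -sumrN; apply: ler_sum => j _; rewrite !mxE mulNr.
Qed.

Lemma norm2_mxv_le A v : norm2 (mxv A v) <= opnorm A * norm2 v.
Proof.
have [v0|v0] := eqVneq (nsq v) 0.
  rewrite (nsq_eq0 _ v0) mxv0 /norm2 -!/(nsq _) nsq0 sqrtr0 mulr0//.
have pv : 0 < norm2 v by rewrite sqrtr_gt0 lt_neqAle eq_sym v0 nsq_ge0.
rewrite -ler_pdivrMr// mulrC -[X in X * _]ger0_norm ?invr_ge0 ?norm2_ge0//.
rewrite -norm2Z -mxvZr.
apply: sup_upper_bound; last first.
  exists ((norm2 v)^-1 *: v) => //=.
  by rewrite norm2Z ger0_norm ?invr_ge0 ?norm2_ge0// mulVf// gt_eqF.
(* [sup] is an upper bound only for a nonempty set that is bounded above: the zero vector gives a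
   point, the Frobenius norm a bound. *)
split; first by exists (norm2 (mxv A 0)), 0 => //=; rewrite /norm2 -/(nsq _) nsq0 sqrtr0.
exists (Num.sqrt (\sum_(i < d) nsq (row i A))) => _ [u /= u1 <-].
apply: ler_wsqrtr; apply: (le_trans (nsq_mxv_le A u)).
rewrite -[leRHS]mulr1 ler_wpM2l ?sumr_ge0// => [i _|]; first exact: nsq_ge0.
by rewrite -sqr_norm2 expr_le1// norm2_ge0.
Qed.
End Euclid.

(** * Taylor estimates along segments *)

Section Calculus.
Context {R : realType} {d : nat}.
Implicit Types (x y v D : 'rV[R]_d) (F : 'rV[R]_d -> R).

(** The difference quotient of the restriction at [t] is literally that of the directional
    derivative of [f] at [x + t *: D]. *)
Lemma is_derive_line {W : normedModType R} (f : 'rV[R]_d -> W) x D (t : R) :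
  differentiable f (x + t *: D) ->
  is_derive t (1 : R) (fun s : R => f (x + s *: D)) ('d f (x + t *: D) D).
Proof.
move=> df.
have E : (fun h : R => h^-1 *: (f (x + (h *: (1 : R) + t) *: D) - f (x + t *: D))) =
   (fun h : R => h^-1 *: ((f \o shift (x + t *: D)) (h *: D) - f (x + t *: D))).
  apply/funext => h /=; congr (_ *: (f _ - _)).
  by rewrite [h *: 1]mulr1 scalerDl addrCA addrA.
have dD : derivable f (x + t *: D) D by exact: diff_derivable.
apply: DeriveDef.
  by move: dD; rewrite /derivable -E.
by rewrite -deriveE// /derive -E.
Qed.

Lemma diffE_grad F x v : differentiable F x -> 'd F x v = dot (grad F x) v.
Proof.
move=> dF; rewrite {1}(row_sum_delta v) linear_sum; apply: eq_bigr => i _.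
by rewrite linearZ /= mxE mulrC.
Qed.

Lemma diff_gradE F x v : differentiable (grad F) x ->
  'd (grad F) x v = mxv (hess F x) v.
Proof.
move=> dF; rewrite {1}(row_sum_delta v) linear_sum; apply/rowP => i.
rewrite summxE mxE; apply: eq_bigr => j _.
by rewrite linearZ /= !mxE mulrC.
Qed.

Lemma nsq_grad_lip (L : R) F x y :
  (forall x y, norm2 (grad F x - grad F y) <= L * norm2 (x - y)) ->
  nsq (grad F x - grad F y) <= L ^+ 2 * nsq (x - y).
Proof.
by move=> lip; rewrite -!sqr_norm2 -exprMn; apply: lerXn2r (lip x y);
  rewrite nnegrE ?norm2_ge0//; apply: le_trans (lip x y); exact: norm2_ge0.
Qed.

Lemma MVT01 (f df : R -> R) : (forall t, is_derive t (1 : R) f (df t)) ->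
  exists2 c, 0 <= c <= 1 & f 1 - f 0 = df c.
Proof.
move=> fdf.
have cf : {within `[0, 1], continuous f}.
  apply: continuous_subspaceT => t; apply: differentiable_continuous.
  by apply/derivable1_diffP; case: (fdf t).
have [c] := MVT_segment ler01 (fun t _ => fdf t) cf.
by rewrite in_itv/= subr0 mulr1; exists c.
Qed.

(** A mean value argument replaces integration along the segment: the gradient increment at the
    intermediate point is paired with [D] by Young's inequality of weight [L]. Each of the two terms
    is at most [L / 2 * nsq D], whence the constant [L]. *)
Lemma descent (L : R) F x y : 0 < L -> (forall x, differentiable F x) ->
  (forall x y, norm2 (grad F x - grad F y) <= L * norm2 (x - y)) ->
  F y <= F x + dot (grad F x) (y - x) + L * nsq (y - x).
Proof.
move=> L0 dF lip; set D := y - x; have xD : x + D = y by rewrite addrC subrK.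
have dphi t : is_derive t (1 : R) (fun t => F (x + t *: D))
    (dot (grad F (x + t *: D)) D).
  by rewrite -diffE_grad//; exact: is_derive_line.
have [c /andP[c0 c1]] := MVT01 _ _ dphi.
rewrite scale1r scale0r addr0 xD => /eqP; rewrite subr_eq => /eqP ->.
rewrite addrC -addrA lerD2l -lerBlDl -dotBl.
apply: (le_trans (dot_young L _ _ L0)).
have := nsq_grad_lip _ _ (x + c *: D) x lip.
have -> : x + c *: D - x = c *: D by rewrite addrAC subrr add0r.
rewrite nsqZ => h.
have : c ^+ 2 * nsq D <= nsq D.
  by rewrite -[leRHS]mul1r ler_wpM2r ?nsq_ge0// expr_le1.
move=> h1.
have -> : L * nsq D = L / 2 * nsq D + (2 * L)^-1 * (L ^+ 2 * nsq D) by field; rewrite gt_eqF.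
rewrite lerD2l ler_wpM2l ?invr_ge0 ?mulr_ge0 ?(ltW L0)//.
by apply: (le_trans h); rewrite ler_wpM2l ?sqr_ge0.
Qed.

Lemma is_derive_dot (r : 'rV[R]_d) (f : R -> 'rV[R]_d) (t : R) df :
  is_derive t (1 : R) f df -> is_derive t (1 : R) (fun s => dot r (f s)) (dot r df).
Proof.
move=> fdf.
have fi i : is_derive t (1 : R) (fun s => f s ord0 i) (df ord0 i).
  have [fd <-] := fdf; apply: DeriveDef; first exact: (derivable_mxP f t 1).1.
  by rewrite derive_mx// mxE.
have -> : (fun s => dot r (f s)) =
    \sum_(i < d) (fun s => r ord0 i *: f s ord0 i).
  by apply/funext => s; rewrite fct_sumE.
apply: is_derive_sum => i; exact: is_deriveZ.
Qed.

(** The mean value theorem does not hold for vector-valued maps, so the remainder [r] is paired with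
    itself: this gives [nsq r] as the product of [r] with a Jacobian increment applied to [D], and
    [le_norm2] cancels one factor [norm2 r]. *)
Lemma lipschitz_jacobian_remainder (rho : R) (f : 'rV[R]_d -> 'rV[R]_d)
    (J : 'rV[R]_d -> 'M[R]_d) x y : 0 <= rho ->
  (forall x, differentiable f x) -> (forall x v, 'd f x v = mxv (J x) v) ->
  (forall x y, opnorm (J x - J y) <= rho * norm2 (x - y)) ->
  norm2 (f y - f x - mxv (J y) (y - x))
    <= rho * norm2 (y - x) ^+ 2.
Proof.
move=> rho0 df dJ lip; set D := y - x; set r := _ - _ - _; have xD : x + D = y by rewrite addrC subrK.
apply: le_norm2; first by rewrite mulr_ge0 ?sqr_ge0.
(* The increment of this auxiliary function over the unit interval is [nsq r]. *)
have dphi t : is_derive t (1 : R)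
    (fun t => dot r (f (x + t *: D)) - t * dot r (mxv (J y) D))
    (dot r (mxv (J (x + t *: D)) D) - dot r (mxv (J y) D)).
  apply: is_deriveB.
    by apply: is_derive_dot; rewrite -dJ; exact: is_derive_line.
  have := @is_deriveM _ _ id (cst (dot r (mxv (J y) D))) t 1 _ _
    (is_derive_id _ _) (is_derive_cst _ _ _).
  by rewrite /= scaler0 add0r [_ *: 1]mulr1.
have [c /andP[c0 c1]] := MVT01 _ _ dphi.
have -> : x + 1 *: D = y by rewrite scale1r.
have -> : x + 0 *: D = x by rewrite scale0r addr0.
have -> : nsq r = dot r (f y) - dot r (f x) - dot r (mxv (J y) D).
  by rewrite -(dotBr r (f y)) -(dotBr r (_ - _)) -dotvv.
move: (dot r (f y)) (dot r (f x)) => p q.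
rewrite -(dotBr r (mxv _ D)) -(mxvBl (J _)) => E.
have -> : p - q - dot r (mxv (J y) D) =
  p - 1 * dot r (mxv (J y) D) - (q - 0 * dot r (mxv (J y) D)) by ring.
rewrite E; apply: (le_trans (cauchy_schwarz _ _)).
rewrite mulrC ler_wpM2r ?norm2_ge0//; apply: (le_trans (norm2_mxv_le _ _)).
rewrite expr2 mulrA ler_wpM2r ?norm2_ge0//; apply: (le_trans (lip _ _)).
rewrite ler_wpM2l//.
have -> : x + c *: D - y = - ((1 - c) *: D).
  by rewrite /D scalerBl scale1r opprB -addrA [c *: _ - _]addrC addrA opprB addrC.
rewrite /norm2 -!/(nsq _) nsqN nsqZ ler_wsqrtr//.
rewrite -[leRHS]mul1r ler_wpM2r ?nsq_ge0// expr_le1 ?subr_ge0//.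
by rewrite lerBlDr lerDl.
Qed.

Lemma Rintegral_sum (I : Type) (s : seq I) (A : set R) (f : I -> R -> R) :
  measurable A ->
  (forall i, lebesgue_measure.-integrable A (EFin \o f i)) ->
  \int[lebesgue_measure]_(t in A) (\sum_(i <- s) f i t) =
  \sum_(i <- s) \int[lebesgue_measure]_(t in A) f i t.
Proof.
move=> mA fi; elim: s => [|i s IH].
  rewrite big_nil; under eq_Rintegral do rewrite big_nil.
  by rewrite Rintegral_cst// mul0r.
rewrite big_cons -IH; under eq_Rintegral do rewrite big_cons.
rewrite RintegralD//.
have -> : EFin \o (fun t => \sum_(j <- s) f j t) =
    (fun t => (\sum_(j <- s) (f j t)%:E)%R).
  by apply/funext => t /=; rewrite sumEFin.
exact: (@integrable_sum _ _ _ lebesgue_measure A mA _ s xpredT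
  (fun j t => (f j t)%:E) (fun j _ => fi j)).
Qed.

(** The fundamental theorem of calculus, applied to each coordinate of [f] along the segment;
    continuity of [J] makes the entries integrable, so the sum over [j] leaves the integral. *)
Lemma jacobian_seg (f : 'rV[R]_d -> 'rV[R]_d) (J : 'rV[R]_d -> 'M[R]_d) x y :
  (forall x, differentiable f x) -> (forall x v, 'd f x v = mxv (J x) v) ->
  continuous J ->
  f y - f x = mxv (\matrix_(i, j) \int[lebesgue_measure]_(t in `[0, 1])
    (J (x + t *: (y - x)) i j)) (y - x).
Proof.
move=> df dJ cJ; set D := y - x; apply/rowP => i.
have xD : x + D = y by rewrite addrC subrK.
have cl : continuous (fun t : R => x + t *: D).
  move=> t; apply: cvgD; first exact: cvg_cst.
  by apply: cvgZr_tmp; exact: cvg_id.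
have cJij j : continuous (fun t : R => J (x + t *: D) i j).
  move=> t; have cJl := continuous_comp (cl t) (cJ _).
  exact: (continuous_comp cJl (@coord_continuous _ _ _ i j _)).
have dphi t : is_derive t (1 : R) (fun t => f (x + t *: D) ord0 i)
    (\sum_(j < d) J (x + t *: D) i j * D ord0 j).
  have [gd dE] : is_derive t (1 : R) (fun t => f (x + t *: D))
      (mxv (J (x + t *: D)) D).
    by rewrite -dJ; exact: is_derive_line.
  apply: DeriveDef; first exact: (derivable_mxP _ t 1).1.
  by have := congr1 (fun M : 'rV[R]_d => M ord0 i) dE; rewrite derive_mx// !mxE.
have cphi : continuous (fun t : R => f (x + t *: D) ord0 i).
  move=> t; apply: differentiable_continuous.
  by apply/derivable1_diffP; case: (dphi t).
have cdphi : continuous (fun t : R => \sum_(j < d) J (x + t *: D) i j * D ord0 j).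
  move=> t; apply: cvg_big; first exact: add_continuous.
  by move=> j _; apply: cvgM; [exact: cJij | exact: cvg_cst].
have intJ j : lebesgue_measure.-integrable `[0, 1]
    (EFin \o (fun t => J (x + t *: D) i j)).
  apply: continuous_compact_integrable; first exact: segment_compact.
  exact: continuous_subspaceT.
have doo : derivable_oo_LRcontinuous (fun t : R => f (x + t *: D) ord0 i) 0 1.
  split => [t _| |]; first by case: (dphi t).
  - exact/cvg_at_right_filter/cphi.
  - exact/cvg_at_left_filter/cphi.
have dE : {in `]0, 1[, (fun t : R => f (x + t *: D) ord0 i)^`()%classic =1
    (fun t => \sum_(j < d) J (x + t *: D) i j * D ord0 j)}.
  by move=> t _; rewrite derive1E; case: (dphi t).
have := continuous_FTC2 ltr01 (continuous_subspaceT cdphi) doo dE.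
have -> : x + 1 *: D = y by rewrite scale1r.
have -> : x + 0 *: D = x by rewrite scale0r addr0.
(* The fundamental theorem is stated for extended-real integrals; [fine] brings it back to
   [Rintegral]. *)
move=> /(congr1 fine); rewrite /= -/(Rintegral _ _ _) => E.
have -> : (f y - f x) ord0 i = f y ord0 i - f x ord0 i by rewrite !mxE.
rewrite -E Rintegral_sum//.
  by rewrite mxE; apply: eq_bigr => j _; rewrite mxE RintegralZr.
move=> j; apply: continuous_compact_integrable; first exact: segment_compact.
apply: continuous_subspaceT => t.
by apply: cvgM; [exact: cJij | exact: cvg_cst].
Qed.
End Calculus.

(** * Pathwise analysis of the iteration *)

Section Scalar.
Context {R : realType}.

(** For one coordinate, [s] is the Adam denominator, [x] the gradient, and [a * x + r] the momentum.
    Once [M] and [del] are replaced by [s], the gap is [(a - om) * x ^+ 2 + (om * x + r) ^+ 2 / (2 *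
    om)] divided by [s]. *)
Lemma preconditioned_young (om a del M s x r : R) :
  0 < om -> om <= a -> 0 < del -> del <= s -> s <= M ->
  - (x * ((a * x + r) / s)) <= - (om / (2 * M) * x ^+ 2) + (2 * om * del)^-1 * r ^+ 2.
Proof.
move=> om0 oma del0 dels sM.
have s0 : 0 < s by exact: lt_le_trans dels.
have M0 : 0 < M by exact: lt_le_trans sM.
have h1 : om / (2 * M) * x ^+ 2 <= om / (2 * s) * x ^+ 2.
  apply: ler_wpM2r; first exact: sqr_ge0.
  by rewrite ler_wpM2l ?(ltW om0)// lef_pV2 ?posrE ?mulr_gt0// ler_wpM2l.
have h2 : (2 * om * s)^-1 * r ^+ 2 <= (2 * om * del)^-1 * r ^+ 2.
  apply: ler_wpM2r; first exact: sqr_ge0.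
  by rewrite lef_pV2 ?posrE ?mulr_gt0// ler_wpM2l// mulr_ge0// ltW.
rewrite -lerN2 in h1; apply: le_trans (lerD h1 h2).
rewrite -subr_ge0.
have -> : - (om / (2 * s) * x ^+ 2) + (2 * om * s)^-1 * r ^+ 2 - - (x * ((a * x + r) / s))
  = ((a - om) * x ^+ 2 + (om * x + r) ^+ 2 / (2 * om)) / s.
  by field; rewrite !gt_eqF.
rewrite divr_ge0 ?(ltW s0)// addr_ge0//.
  by rewrite mulr_ge0 ?sqr_ge0 ?subr_ge0.
by rewrite divr_ge0 ?sqr_ge0// mulr_ge0// ltW.
Qed.

Lemma sqr_le_of_norm (x c : R) : `|x| <= c -> x ^+ 2 <= c ^+ 2.
Proof.
by move=> xc; rewrite -real_normK ?num_real// lerXn2r// nnegrE (le_trans _ xc).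
Qed.
End Scalar.

(** Induction step of [potential] over plain scalars, linear once monomials count as unknowns. [S1]
    and [S2] are the sums of squared gradients and noises, [D] and [e] their next terms, [p] the
    previous squared noise, [r] and [r'] the squared drifts. *)
Lemma potential_arith (R : realFieldType)
    (eta c K A Q X LV t S1 S2 f f' f0 p e r r' D : R) :
  eta * (c * S1) + f + eta * (A * r) + eta * (K * Q * p) <=
    f0 + t * (eta ^+ 2 * (LV + K * X)) + eta * (2 * K * Q * S2) ->
  f' <= f + eta * (- (c * D) + K * r') + eta ^+ 2 * LV ->
  eta * ((K + A) * r') <= eta * (A * r + K * (Q * (e + p) + X * eta ^+ 2)) ->
  eta * (K * (X * eta ^+ 2)) <= eta ^+ 2 * (K * X) ->
  eta * (c * (S1 + D)) + f' + eta * (A * r') + eta * (K * Q * e) <=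
    f0 + (t + 1) * (eta ^+ 2 * (LV + K * X)) + eta * (2 * K * Q * (S2 + e)).
Proof. by move=> *; lra. Qed.

Section Vectors.
Context {R : realType} {d : nat}.
Implicit Types (p q u v m x y : 'rV[R]_d).

Lemma nsq_comb3 (a b c : R) u v m :
  nsq (a *: u + b *: v + c *: m) <=
  3 * (a ^+ 2 * nsq u + b ^+ 2 * nsq v + c ^+ 2 * nsq m).
Proof. by rewrite -!nsqZ nsqD3. Qed.

(** [x], [y] stand for consecutive stochastic gradients and [p], [q] for the exact ones. *)
Lemma extrapolation_split (a : R) x y p q :
  x + a *: (x - y) =
  p + ((1 + a) *: (x - p) + (- a) *: (y - q) + a *: (p - q)).
Proof. by apply/rowP => i; rewrite !mxE; ring. Qed.

(** Moving the centre of the drift from [q] to [p] costs [b * (1 - bk)] times [p - q]; divided by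
    [1 - b], this joins the new increment. *)
Lemma momentum_drift (b bk a : R) m p q u v : 1 - b != 0 ->
  b *: m + (1 - b) *: (p + (u + v + a *: (p - q))) - (1 - b * bk) *: p =
  b *: (m - (1 - bk) *: q)
  + (1 - b) *: (u + v + (a - b * (1 - bk) / (1 - b)) *: (p - q)).
Proof. by move=> b1; apply/rowP => i; rewrite !mxE; field. Qed.
End Vectors.

(** * Uniform bounds along one trajectory *)

Section AdamRun.
(* Keeps unification from unfolding [grad F x] to a differential. *)
Local Opaque grad.
Context {R : realType} {d : nat}.
Variables (beta1 beta2 delta eta : R) (theta0 : 'rV[R]_d).
Variables (g : nat -> 'rV[R]_d) (alpha : nat -> R) (G Ca : R).
Hypotheses (b1 : 0 <= beta1 < 1) (b2 : 0 <= beta2 < 1).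
Hypotheses (delta_gt0 : 0 < delta) (eta_gt0 : 0 < eta) (eta_le1 : eta <= 1).
Hypotheses (alpha0 : alpha 0 = 0) (alpha_le : forall k, `|alpha k| <= Ca).
Hypothesis (g_le : forall k, norm2 (g k) <= G).

Local Notation state := (adam_state beta1 beta2 delta eta theta0 g alpha).
Local Notation theta := (adam_theta beta1 beta2 delta eta theta0 g alpha).
Local Notation theta_prev := (adam_theta_prev beta1 beta2 delta eta theta0 g alpha).
Local Notation gt := (gtilde g alpha).

(* Indices are shifted by one: [mom k] is the paper's m_(k-1), and similarly for [vel]. *)
Local Notation mom k := (state k).1.2.
Local Notation vel k := (state k).2.

Lemma momS k : mom k.+1 = beta1 *: mom k + (1 - beta1) *: gt k.
Proof. by rewrite /=; case: (state k) => [[]]. Qed.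

Lemma velS k i : vel k.+1 ord0 i =
  beta2 * vel k ord0 i + (1 - beta2) * gt k ord0 i ^+ 2.
Proof. by rewrite /=; case: (state k) => [[th m v]] /=; rewrite !mxE. Qed.

Lemma thetaS k : theta k.+1 = theta k - eta *:
  \row_i (mom k.+1 ord0 i / (Num.sqrt (vel k.+1 ord0 i) + delta)).
Proof. by rewrite /adam_theta /=; case: (state k) => [[]]. Qed.

Let V := 6 * (1 + Ca) ^+ 2 * G ^+ 2.

Lemma V_ge0 : 0 <= V.
Proof. by rewrite /V mulr_ge0 ?sqr_ge0// mulr_ge0 ?sqr_ge0. Qed.

Lemma nsq_g k : nsq (g k) <= G ^+ 2.
Proof.
rewrite -sqr_norm2; apply: lerXn2r (g_le k); rewrite nnegrE ?norm2_ge0//.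
by apply: le_trans (g_le k); exact: norm2_ge0.
Qed.

(** The 6 in [V] is the 3 of [nsqD3] times two terms, each at most [(1 + Ca) ^+ 2 * G ^+ 2]. *)
Lemma nsq_gt k : nsq (gt k) <= V.
Proof.
have gp : nsq (gprev g k) <= G ^+ 2.
  by case: k => [|k] /=; [rewrite nsq0 sqr_ge0 | exact: nsq_g].
have -> : gt k = (1 + alpha k) *: g k + (- alpha k) *: gprev g k + 0.
  by rewrite /gtilde addr0 scalerDl scale1r scalerBr addrA scaleNr.
apply: (le_trans (nsqD3 _ _ _)); rewrite nsq0 addr0 !nsqZ.
have a1 : (1 + alpha k) ^+ 2 <= (1 + Ca) ^+ 2.
  apply: sqr_le_of_norm; apply: le_trans (ler_normD _ _) _.
  by rewrite normr1 lerD2l.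
have a2 : (- alpha k) ^+ 2 <= (1 + Ca) ^+ 2.
  apply: sqr_le_of_norm; rewrite normrN; apply: (le_trans (alpha_le k)).
  by rewrite lerDr.
have := ler_pM (sqr_ge0 _) (nsq_ge0 _) a1 (nsq_g k).
have := ler_pM (sqr_ge0 _) (nsq_ge0 _) a2 gp.
by rewrite /V; lra.
Qed.

Lemma nsq_mom k : nsq (mom k) <= V.
Proof.
elim: k => [|k IH]; first by rewrite /= nsq0 V_ge0.
have /andP[b0 b1'] := b1.
rewrite momS; apply: le_trans (nsqD_convex _ _ _ _) _; first by rewrite b0 ltW.
have := nsq_gt k; move: IH b0 b1' => /= IH b0 b1' hg; nra.
Qed.

(** Convex combinations of squares, started at 0. The denominators therefore stay between [delta]
    and [Num.sqrt V + delta] on every path. *)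
Lemma vel_bound k i : 0 <= vel k ord0 i <= V.
Proof.
elim: k => [|k IH]; first by rewrite /= mxE lexx V_ge0.
rewrite velS; have /andP[b0 b1'] := b2; have := sqr_ge0 (gt k ord0 i).
have : gt k ord0 i ^+ 2 <= V.
  apply: le_trans (nsq_gt k); rewrite /nsq (bigD1 i)//= lerDl.
  by apply: sumr_ge0 => j _; exact: sqr_ge0.
move: IH; move: (vel k ord0 i) (_ ^+ 2) => p q /andP[p0 pV] qV q0.
by apply/andP; split; nra.
Qed.

Lemma nsq_step k : nsq (theta k.+1 - theta k) <= eta ^+ 2 * (V / delta ^+ 2).
Proof.
rewrite thetaS addrAC subrr add0r nsqN nsqZ ler_wpM2l ?sqr_ge0//.
rewrite ler_pdivlMr ?exprn_gt0//; apply: le_trans (nsq_mom k.+1).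
rewrite /nsq mulr_suml; apply: ler_sum => i _; rewrite mxE.
have s0 : 0 <= Num.sqrt (vel k.+1 ord0 i) by exact: sqrtr_ge0.
have s1 : 0 < Num.sqrt (vel k.+1 ord0 i) + delta by rewrite ltr_wpDl.
rewrite expr_div_n mulrAC ler_pdivrMr ?exprn_gt0// ler_wpM2l ?sqr_ge0//.
by apply: lerXn2r; rewrite ?nnegrE ?(ltW delta_gt0) ?(ltW s1)// lerDr.
Qed.

(** * Recursion for the momentum error and the telescoping potential *)

Variables (F : 'rV[R]_d -> R) (L : R).
Hypotheses (L_gt0 : 0 < L) (F_diff : forall x, differentiable F x).
Hypothesis F_lip : forall x y, norm2 (grad F x - grad F y) <= L * norm2 (x - y).

Local Notation gradk k := (grad F (theta k)).
Local Notation gradp k := (grad F (theta_prev k)).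

Let noise k := g k - gradk k.
(** The value 0 at index 0 is consistent because its coefficient there is [- alpha 0 = 0]; it also
    makes the potential start without a noise term. *)
Let noise_prev k := if k is k'.+1 then noise k' else 0.

(* Deviation of the momentum from a multiple of the exact gradient. *)
Let drift k := mom k - (1 - beta1 ^+ k) *: gradp k.

(** The geometric sum of [beta1 ^+ j] for [j] from 1 to [k], which is the recentring cost found in
    [momentum_drift]. *)
Let gam k := beta1 * (1 - beta1 ^+ k) / (1 - beta1).
Let incr k := (1 + alpha k) *: noise k + (- alpha k) *: noise_prev k
   + (alpha k - gam k) *: (gradk k - gradp k).

Lemma omb1_gt0 : 0 < 1 - beta1.
Proof. by rewrite subr_gt0; have /andP[] := b1. Qed.

Lemma driftS k : drift k.+1 = beta1 *: drift k + (1 - beta1) *: incr k.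
Proof.
have gt_dec : gt k = gradk k + ((1 + alpha k) *: noise k
    + (- alpha k) *: noise_prev k + alpha k *: (gradk k - gradp k)).
  case: k => [|k]; last exact: extrapolation_split.
  (* At index 0, [gprev] and [noise_prev] are conventional zeros, and [alpha 0 = 0] removes both. *)
  rewrite /gtilde alpha0 !scale0r addr0 oppr0 scale0r !addr0 scale1r.
  by rewrite /noise addrC subrK.
rewrite /drift momS gt_dec exprS; apply: momentum_drift.
by rewrite gt_eqF// omb1_gt0.
Qed.

(** Both factors 3 come from [nsqD3]: [Q] weighs the two noises, [X] the squared gradient increment
    with its [eta ^+ 2] taken out. *)
Let Q := 3 * (1 + Ca) ^+ 2.
Let X := 3 * (Ca + (1 - beta1)^-1) ^+ 2 * (L ^+ 2 * (V / delta ^+ 2)).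

Lemma X_ge0 : 0 <= X.
Proof.
rewrite /X mulr_ge0//; first by rewrite mulr_ge0 ?sqr_ge0.
by rewrite mulr_ge0 ?sqr_ge0// divr_ge0 ?V_ge0 ?sqr_ge0.
Qed.

Lemma gam_bound k : `|gam k| <= (1 - beta1)^-1.
Proof.
have /andP[b0 b1'] := b1; have o0 := omb1_gt0.
have p0 : 0 <= beta1 ^+ k by exact: exprn_ge0.
have p1 : beta1 ^+ k <= 1 by rewrite exprn_ile1// ltW.
rewrite /gam ger0_norm; last by rewrite divr_ge0 ?(ltW o0)// mulr_ge0// subr_ge0.
rewrite -[leRHS]mul1r ler_wpM2r ?invr_ge0 ?(ltW o0)//.
by rewrite mulr_ile1 ?subr_ge0 ?(ltW b1')// lerBlDr lerDl.
Qed.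

Lemma nsq_grad_step k : nsq (gradk k - gradp k) <=
  L ^+ 2 * (eta ^+ 2 * (V / delta ^+ 2)).
Proof.
case: k => [|k].
  rewrite /= subrr nsq0 mulr_ge0 ?sqr_ge0// mulr_ge0 ?sqr_ge0//.
  by rewrite divr_ge0 ?V_ge0 ?sqr_ge0.
apply: (le_trans (nsq_grad_lip _ _ _ _ F_lip)).
by rewrite ler_wpM2l ?sqr_ge0//; exact: nsq_step.
Qed.

Lemma nsq_incr k :
  nsq (incr k) <= Q * (nsq (noise k) + nsq (noise_prev k)) + X * eta ^+ 2.
Proof.
have aC := alpha_le k.
have a1 : (1 + alpha k) ^+ 2 <= (1 + Ca) ^+ 2.
  apply: sqr_le_of_norm; apply: le_trans (ler_normD _ _) _.
  by rewrite normr1 lerD2l.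
have a2 : (- alpha k) ^+ 2 <= (1 + Ca) ^+ 2.
  by apply: sqr_le_of_norm; rewrite normrN; apply: (le_trans aC); rewrite lerDr.
have a3 : (alpha k - gam k) ^+ 2 <= (Ca + (1 - beta1)^-1) ^+ 2.
  apply: sqr_le_of_norm; apply: le_trans (ler_normB _ _) _.
  by rewrite lerD// gam_bound.
apply: (le_trans (nsq_comb3 _ _ _ _ _ _)).
have h1 := ler_wpM2r (nsq_ge0 (noise k)) a1.
have h2 := ler_wpM2r (nsq_ge0 (noise_prev k)) a2.
have h3 := ler_pM (sqr_ge0 _) (nsq_ge0 _) a3 (nsq_grad_step k).
have -> : X * eta ^+ 2 = 3 * ((Ca + (1 - beta1)^-1) ^+ 2 *
   (L ^+ 2 * (eta ^+ 2 * (V / delta ^+ 2)))) by rewrite /X; ring.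
have -> : Q * (nsq (noise k) + nsq (noise_prev k)) = 3 * ((1 + Ca) ^+ 2 * nsq (noise k)
   + (1 + Ca) ^+ 2 * nsq (noise_prev k)) by rewrite /Q; ring.
by rewrite -mulrDr ler_wpM2l// lerD// lerD.
Qed.

(** [c] and [K] are the constants of [preconditioned_young] for [om = 1 - beta1] and
    [del = delta]. *)
Let M := Num.sqrt V + delta.
Let c := (1 - beta1) / (2 * M).
Let K := (2 * (1 - beta1) * delta)^-1.

Lemma one_step k : F (theta k.+1) <= F (theta k)
  + eta * (- (c * nsq (gradk k)) + K * nsq (drift k.+1))
  + eta ^+ 2 * (L * (V / delta ^+ 2)).
Proof.
have /andP[b0 b1'] := b1; have o0 := omb1_gt0.
apply: (le_trans (descent L F (theta k) (theta k.+1) L_gt0 F_diff F_lip)).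
apply: lerD; last by rewrite mulrCA ler_wpM2l ?(ltW L_gt0)//; exact: nsq_step.
rewrite lerD2l.
have -> : dot (gradk k) (theta k.+1 - theta k) = eta *
    \sum_(i < d) - (gradk k ord0 i * (((1 - beta1 ^+ k.+1) * gradk k ord0 i
      + drift k.+1 ord0 i) / (Num.sqrt (vel k.+1 ord0 i) + delta))).
  rewrite thetaS addrAC subrr add0r mulr_sumr; apply: eq_bigr => i _.
  have -> : drift k.+1 ord0 i = mom k.+1 ord0 i - (1 - beta1 ^+ k.+1) * gradk k ord0 i.
    by rewrite /drift !mxE.
  by rewrite [_ + (_ - _)]addrC subrK !mxE; ring.
rewrite ler_wpM2l ?(ltW eta_gt0)// /nsq !mulr_sumr -sumrN -big_split.
apply: ler_sum => i _; have /andP[v0 vV] := vel_bound k.+1 i.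
apply: preconditioned_young => //.
(* The gradient weight [1 - beta1 ^+ k.+1] in the momentum never falls below [1 - beta1]. *)
- by rewrite lerB// exprS ler_piMr// exprn_ile1// ltW.
- by rewrite lerDr sqrtr_ge0.
- by rewrite lerD2r ler_wsqrtr.
Qed.

(** Solves [beta1 * (K + A) = A]: the drift cost of a step plus the new potential term contracts to
    exactly the old potential term. *)
Let A := beta1 * K / (1 - beta1).

Lemma K_ge0 : 0 <= K.
Proof.
by rewrite /K invr_ge0 mulr_ge0 ?(ltW delta_gt0)// mulr_ge0// ltW// omb1_gt0.
Qed.

(** Each noise enters two consecutive increments, hence the factor 2 on the right; the term in
    [noise_prev] prepays its second appearance. *)
Lemma potential T :
  eta * (c * \sum_(k < T) nsq (gradk k)) + F (theta T)
    + eta * (A * nsq (drift T)) + eta * (K * Q * nsq (noise_prev T)) <=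
  F theta0 + T%:R * (eta ^+ 2 * (L * (V / delta ^+ 2) + K * X))
    + eta * (2 * K * Q * \sum_(k < T) nsq (noise k)).
Proof.
have o0 := omb1_gt0; have K0 := K_ge0; have /andP[b0 b1'] := b1.
elim: T => [|T IH].
  (* Initially the drift vanishes, since [mom 0] and [1 - beta1 ^+ 0] are both zero. *)
  rewrite !big_ord0 /drift /= expr0 subrr scale0r subr0 nsq0 !mulr0 mul0r.
  by rewrite add0r !addr0.
have h1 := one_step T.
have h2 : (K + A) * nsq (drift T.+1) <= A * nsq (drift T) + K * nsq (incr T).
  have -> : K + A = K / (1 - beta1) by rewrite /A; field; rewrite gt_eqF.
  have -> : A * nsq (drift T) + K * nsq (incr T) = K / (1 - beta1) *
    (beta1 * nsq (drift T) + (1 - beta1) * nsq (incr T)).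
    by rewrite /A; field; rewrite gt_eqF.
  rewrite ler_wpM2l ?divr_ge0 ?(ltW o0)// driftS nsqD_convex//.
  by rewrite b0 ltW.
have h3 := ler_wpM2l K0 (nsq_incr T).
have h4 := ler_wpM2l (ltW eta_gt0) (le_trans h2 (lerD (lexx _) h3)).
(* Here [eta <= 1] lowers a third power of [eta] to a square. *)
have h5 : eta * (K * (X * eta ^+ 2)) <= eta ^+ 2 * (K * X).
  have -> : eta * (K * (X * eta ^+ 2)) = eta * (eta ^+ 2 * (K * X)) by ring.
  rewrite ler_piMl// mulr_ge0 ?sqr_ge0// mulr_ge0//; exact: X_ge0.
rewrite !big_ord_recr -natr1 [noise_prev _]/=.
exact: potential_arith IH h1 h4 h5.
Qed.

(** The nonnegative drift and noise terms of the potential are dropped, [F] at the last iterate is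
    bounded below by [Fstar], and [eta] is divided out. *)
Lemma sum_grad_le (Fstar : R) T : (forall x, Fstar <= F x) ->
  c * \sum_(k < T) nsq (gradk k) <= (F theta0 - Fstar) / eta
    + T%:R * eta * (L * (V / delta ^+ 2) + K * X)
    + 2 * K * Q * \sum_(k < T) nsq (g k - gradk k).
Proof.
move=> Fs; have P := potential T; have K0 := K_ge0.
rewrite -(ler_pM2l eta_gt0).
have -> : eta * ((F theta0 - Fstar) / eta + T%:R * eta * (L * (V / delta ^+ 2) + K * X)
    + 2 * K * Q * \sum_(k < T) nsq (g k - gradk k)) =
  F theta0 + T%:R * (eta ^+ 2 * (L * (V / delta ^+ 2) + K * X))
    + eta * (2 * K * Q * \sum_(k < T) nsq (noise k)) - Fstar.
  by rewrite /noise; field; rewrite !gt_eqF.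
rewrite lerBrDr; apply: le_trans P; rewrite -addrA -addrA lerD2l.
apply: (le_trans (Fs (theta T))); rewrite lerDl addr_ge0//.
  rewrite mulr_ge0 ?(ltW eta_gt0)// mulr_ge0 ?nsq_ge0// /A.
  by rewrite divr_ge0 ?(ltW omb1_gt0)// mulr_ge0//; have /andP[] := b1.
rewrite mulr_ge0 ?(ltW eta_gt0)// mulr_ge0 ?nsq_ge0// mulr_ge0//.
by rewrite /Q mulr_ge0// sqr_ge0.
Qed.
End AdamRun.

(** * Measurability and integration *)

Section Measurability.
Context {R : realType} {dT : measure_display} {T : measurableType dT} {d : nat}.
Implicit Types (X : T -> 'rV[R]_d).

Definition coord_measurable X :=
  forall i, measurable_fun setT (fun w => X w ord0 i).

Lemma coord_measurableD X Y : coord_measurable X -> coord_measurable Y ->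
  coord_measurable (fun w => X w + Y w).
Proof.
move=> mX mY i; under eq_fun do rewrite mxE.
exact: measurable_funD.
Qed.

Lemma coord_measurableB X Y : coord_measurable X -> coord_measurable Y ->
  coord_measurable (fun w => X w - Y w).
Proof.
move=> mX mY i; under eq_fun do rewrite !mxE.
exact: measurable_funB.
Qed.

Lemma coord_measurableZ (a : T -> R) X : measurable_fun setT a ->
  coord_measurable X -> coord_measurable (fun w => a w *: X w).
Proof.
move=> ma mX i; under eq_fun do rewrite !mxE.
exact: measurable_funM.
Qed.

Lemma measurable_nsq X : coord_measurable X ->
  measurable_fun setT (fun w => nsq (X w)).
Proof.
move=> mX; apply: measurable_sum => i.
exact: measurable_funX.
Qed.

(* Coordinatewise measurability suffices because open sets are countable unions of
   boxes with rational centre and radius. *)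
Lemma measurable_preimage_open X (U : set 'rV[R]_d) :
  coord_measurable X -> open U -> measurable (X @^-1` U).
Proof.
move=> mX oU.
pose box (q : 'rV[rat]_d * rat) : set 'rV[R]_d :=
  [set y | forall i, `|y ord0 i - ratr (q.1 ord0 i)| < ratr q.2].
have -> : X @^-1` U = \bigcup_(q in [set q | box q `<=` U]) X @^-1` (box q).
  apply/seteqP; split => [w Uw|w [q qU /qU]//].
  have /nbhs_ballP[e /= e0 eU] : nbhs (X w) U by exact: open_nbhs_nbhs.
  (* With radius below [e / 2] and a rational centre within that radius of [X w], the triangle
     inequality puts the box inside the ball of radius [e]. *)
  have [r re] : exists r : rat, ratr r \in `]0, (e / 2)[.
    by apply: rat_in_itvoo; rewrite divr_gt0.
  move: re; rewrite in_itv/= => /andP[r0 re].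
  have qP i : exists q : rat, ratr q \in `]X w ord0 i - ratr r, X w ord0 i + ratr r[.
    by apply: rat_in_itvoo; rewrite ltrBlDr -addrA ltrDl addr_gt0.
  have [f fP] := choice qP.
  have fr i : `|X w ord0 i - ratr (f i)| < ratr r.
    by have := fP i; rewrite in_itv/= ltr_distlC ltrBlDr => /andP[? ?]; apply/andP.
  exists (\row_i f i, r) => /=; last by move=> i; rewrite mxE.
  move=> y /= yq; apply: eU; split => // i j; rewrite ord1.
  rewrite /ball /=; apply: le_lt_trans (ler_distD (ratr (f j)) _ _) _.
  rewrite [e]splitr ltrD// ?(lt_trans (fr j))//.
  by rewrite distrC; have := yq j; rewrite mxE => /lt_trans; apply.
rewrite bigcup_mkcond; apply: countable_bigcupT_measurable; first exact: countableP.
move=> q; case: ifP => // _.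
have -> : X @^-1` box q = \bigcap_(i in [set: 'I_d])
    ((fun w => X w ord0 i) @^-1` `]ratr (q.1 ord0 i) - ratr q.2, ratr (q.1 ord0 i) + ratr q.2[).
  apply/seteqP; split => [w h i _ /=|w h i].
    by rewrite in_itv/= -ltr_distl; exact: h.
  by have := h i I; rewrite /= in_itv/= -ltr_distl.
apply: fin_bigcap_measurable => // i _; rewrite -[X in measurable X]setTI.
exact: mX.
Qed.

Lemma measurable_continuous_comp X (f : 'rV[R]_d -> R) :
  coord_measurable X -> continuous f -> measurable_fun setT (fun w => f (X w)).
Proof.
move=> mX /continuousP cf; apply: (measurability _ (RGenOpens.measurableE R)).
move=> _ [_ [a [b ->] <-]]; rewrite setTI.
exact: (measurable_preimage_open X _ mX (cf _ (interval_open _ _))).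
Qed.

(** [Num.sqrt] is continuous and nonnegative on the whole line, so the denominator never vanishes
    and the function is continuous. *)
Lemma measurable_inv_sqrtD (delta : R) : 0 < delta ->
  measurable_fun setT (fun x : R => (Num.sqrt x + delta)^-1).
Proof.
move=> d0; apply: continuous_measurable_fun => x.
apply: (@continuous_comp _ _ _ (fun x : R => Num.sqrt x + delta) GRing.inv).
  by apply: cvgD; [exact: sqrt_continuous | exact: cvg_cst].
by apply: inv_continuous; rewrite gt_eqF// ltr_wpDl// sqrtr_ge0.
Qed.

(** * Measurability of the iterates *)

Section Run.
Variables (beta1 beta2 delta eta : R) (theta0 : 'rV[R]_d).
Variables (g : nat -> T -> 'rV[R]_d) (alpha : nat -> T -> R).
Hypotheses (delta_gt0 : 0 < delta) (mg : forall k, coord_measurable (g k)).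
Hypothesis malpha : forall k, measurable_fun setT (alpha k).

Local Notation state k w :=
  (adam_state beta1 beta2 delta eta theta0 (fun j => g j w) (fun j => alpha j w) k).

Lemma coord_measurable_gtilde k :
  coord_measurable (fun w => gtilde (fun j => g j w) (fun j => alpha j w) k).
Proof.
apply: coord_measurableD => //; apply: coord_measurableZ => //.
apply: coord_measurableB => //; by case: k => [|k] //= i.
Qed.

(** The three components go through one induction because the next iterate uses the momentum and
    second moment just computed. *)
Lemma coord_measurable_state k :
  [/\ coord_measurable (fun w => (state k w).1.1),
      coord_measurable (fun w => (state k w).1.2) &
      coord_measurable (fun w => (state k w).2)].
Proof.
elim: k => [|k [mth mm mv]]; first by split => i /=; exact: measurable_cst.
have mm' : coord_measurable (fun w => (state k.+1 w).1.2).
  under eq_fun do rewrite momS.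
  apply: coord_measurableD; apply: coord_measurableZ => //.
  exact: coord_measurable_gtilde.
have mv' : coord_measurable (fun w => (state k.+1 w).2).
  move=> i; under eq_fun do rewrite velS.
  apply: measurable_funD; apply: measurable_funM => //.
  exact/measurable_funX/coord_measurable_gtilde.
split => //; move=> i.
have -> : (fun w => (state k.+1 w).1.1 ord0 i) = (fun w => (state k w).1.1 ord0 i
   - eta * ((state k.+1 w).1.2 ord0 i *
       (Num.sqrt ((state k.+1 w).2 ord0 i) + delta)^-1)).
  by apply/funext => w; rewrite -[(_ k.+1).1.1]/(adam_theta _ _ _ _ _ _ _ _) thetaS !mxE.
apply: measurable_funB; first exact: mth.
apply: measurable_funM => //; apply: measurable_funM; first exact: mm'.
exact: (measurableT_comp (measurable_inv_sqrtD _ delta_gt0) (mv' i)).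
Qed.
End Run.
End Measurability.

(** * From pathwise bounds to expectations *)

Lemma integral_sum_le {R : realType} {dT : measure_display} {T : measurableType dT}
    (P : probability T R) (n : nat) (D E : nat -> T -> R) (a b s : R) :
  0 <= a -> 0 <= b ->
  (forall k, measurable_fun setT (D k)) -> (forall k, measurable_fun setT (E k)) ->
  (forall k w, 0 <= D k w) -> (forall k w, 0 <= E k w) ->
  (forall k, \int[P]_w (E k w)%:E <= s%:E)%E ->
  (forall w, \sum_(k < n) D k w <= a + b * \sum_(k < n) E k w) ->
  (\sum_(k < n) \int[P]_w (D k w)%:E <= (a + b * (n%:R * s))%:E)%E.
Proof.
move=> a0 b0 mD mE D0 E0 Es DE.
have mDE k : measurable_fun setT (fun w => (D k w)%:E) by exact/measurable_EFinP.
have mEE k : measurable_fun setT (fun w => (E k w)%:E) by exact/measurable_EFinP.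
have mS : measurable_fun setT (fun w => \sum_(k < n) E k w) by exact: measurable_sum.
have S0 w : 0 <= \sum_(k < n) E k w by exact: sumr_ge0.
(* All integrands are nonnegative, so sums and integrals are exchanged from measurability alone. *)
rewrite -(@ge0_integral_sum _ _ _ P setT measurableT _
  (fun (k : 'I_n) w => (D k w)%:E))//; last by move=> k w _; rewrite lee_fin.
apply: (@le_trans _ _ (\int[P]_w (a + b * \sum_(k < n) E k w)%:E)%E).
  apply: ge0_le_integral => //.
  - by move=> w _; apply: sume_ge0 => k _; rewrite lee_fin.
  - exact: emeasurable_sum.
  - by apply/measurable_EFinP; apply: measurable_funD => //; exact: measurable_funM.
  - by move=> w _; rewrite sumEFin lee_fin.
under eq_integral do rewrite EFinD EFinM.
have b_ge0 w : (0 <= b%:E * (\sum_(k < n) E k w)%:E)%E by rewrite -EFinM lee_fin mulr_ge0.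
have mbS : measurable_fun setT (fun w => b%:E * (\sum_(k < n) E k w)%:E)%E.
  by apply/measurable_EFinP; exact: measurable_funM.
have S0' w : (0 <= (\sum_(k < n) E k w)%:E)%E by rewrite lee_fin.
rewrite ge0_integralD ?lee_fin// ge0_integralZl_EFin//; last exact/measurable_EFinP.
have Pa : (\int[P]__ a%:E = a%:E)%E.
  by rewrite -[RHS]mule1 -(probability_setT P); exact: integral_cst.
rewrite Pa EFinD leeD2l// EFinM lee_wpmul2l ?lee_fin//.
under eq_integral do rewrite -sumEFin.
rewrite (@ge0_integral_sum _ _ _ P setT measurableT _ (fun (k : 'I_n) w => (E k w)%:E))//;
  last by move=> k w _; rewrite lee_fin.
apply: (@le_trans _ _ (\sum_(k < n) s%:E)%E); first exact: lee_sum.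
by rewrite sumEFin sumr_const card_ord mulr_natl.
Qed.

Theorem theorem2 (R : realType) (d : nat) (L delta beta1 G alpha_base : R) :
  0 < L -> 0 < delta -> 0 <= beta1 < 1 -> 0 < alpha_base ->
  exists C1 C2 C3 : R, [/\ 0 < C1, 0 < C2 & 0 < C3] /\
  forall (F : 'rV[R]_d -> R) (rho sigma beta2 eta : R)
         (dT : measure_display) (T : measurableType dT) (P : probability T R)
         (theta0 : 'rV[R]_d) (g : nat -> T -> 'rV[R]_d) (alpha : nat -> T -> R),
    (* F is C^2 *)
    (forall x, differentiable F x) ->
    (forall x, differentiable (grad F) x) ->
    continuous (hess F) ->
    (* L-Lipschitz gradient *)
    (forall x y, norm2 (grad F x - grad F y) <= L * norm2 (x - y)) ->
    (* lower bounded *)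
    (exists M, forall x, M <= F x) ->
    (* rho-Lipschitz Hessian *)
    0 <= rho ->
    (forall x y, opnorm (hess F x - hess F y) <= rho * norm2 (x - y)) ->
    (* parameters *)
    0 <= beta2 < 1 -> 0 < eta -> eta <= Num.min 1 L^-1 -> 0 <= sigma ->
    (* coefficients alpha_k *)
    (forall k, measurable_fun setT (alpha k)) ->
    (forall w, alpha 0 w = 0) ->
    (forall k w, `|alpha k w| <= 2 * alpha_base) ->
    (* stochastic gradients *)
    (forall k i, measurable_fun setT (fun w => g k w ord0 i)) ->
    (forall k w, norm2 (g k w) <= G) ->
    let theta k w :=
      adam_theta beta1 beta2 delta eta theta0
        (fun j => g j w) (fun j => alpha j w) k in
    let theta_prev k w :=
      adam_theta_prev beta1 beta2 delta eta theta0
        (fun j => g j w) (fun j => alpha j w) k in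
    (forall k i, condexp_eq P (sigma_of (theta k))
                   (fun w => g k w ord0 i)
                   (fun w => grad F (theta k w) ord0 i)) ->
    (forall k, condexp_le P (sigma_of (theta k))
                 (fun w => norm2 (g k w - grad F (theta k w)) ^+ 2)
                 (sigma ^+ 2)) ->
    let C_alpha := 2 * alpha_base in
    let ntilde k w := grad F (theta k w) +
          alpha k w *: (grad F (theta k w) - grad F (theta_prev k w)) in
    [/\
      (forall k w, grad F (theta k w) - grad F (theta_prev k w) =
          mxv (seg_hess_int F (theta_prev k w) (theta k w))
              (theta k w - theta_prev k w)),
      (forall k w, ntilde k w = grad F (theta k w) + alpha k w *:
          mxv (seg_hess_int F (theta_prev k w) (theta k w))
              (theta k w - theta_prev k w)),
      (forall k w, norm2 (ntilde k w - grad F (theta k w)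
            - alpha k w *: mxv (hess F (theta k w)) (theta k w - theta_prev k w))
          <= C_alpha * rho * norm2 (theta k w - theta_prev k w) ^+ 2) &
      (forall T : nat, (1 <= T)%N ->
         ((T%:R)^-1%:E * \sum_(k < T) \int[P]_w (norm2 (grad F (theta k w)) ^+ 2)%:E
          <= (C1 * (F theta0 - Finf F + G ^+ 2) / (eta * T%:R)
              + C2 * eta + C3 * sigma ^+ 2)%:E)%E)].
Proof.
move=> L0 del0 b1 ab0; have /andP[b10 b1lt] := b1.
(* These are the constants of the pathwise analysis; they are fixed before [F], [sigma], [beta2],
   [eta] and the probability space are introduced. *)
pose Ca := 2 * alpha_base; pose V := 6 * (1 + Ca) ^+ 2 * G ^+ 2.
pose c := (1 - beta1) / (2 * (Num.sqrt V + delta)).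
pose K := (2 * (1 - beta1) * delta)^-1; pose Q := 3 * (1 + Ca) ^+ 2.
pose X := 3 * (Ca + (1 - beta1)^-1) ^+ 2 * (L ^+ 2 * (V / delta ^+ 2)).
pose W := L * (V / delta ^+ 2) + K * X.
have Ca0 : 0 < Ca by rewrite mulr_gt0.
have o0 : 0 < 1 - beta1 by rewrite subr_gt0.
have V0 : 0 <= V by rewrite /V mulr_ge0 ?sqr_ge0// mulr_ge0 ?sqr_ge0.
have c0 : 0 < c by rewrite divr_gt0// mulr_gt0// ltr_wpDl// sqrtr_ge0.
have K0 : 0 < K by rewrite invr_gt0 mulr_gt0// mulr_gt0.
have Q0 : 0 < Q by rewrite mulr_gt0// exprn_gt0// addr_gt0.
have Vd0 : 0 <= V / delta ^+ 2 by rewrite divr_ge0 ?sqr_ge0.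
have X0 : 0 <= X.
  by rewrite mulr_ge0 ?(mulr_ge0 (sqr_ge0 _) Vd0)// mulr_ge0 ?sqr_ge0.
have W0 : 0 <= W := addr_ge0 (mulr_ge0 (ltW L0) Vd0) (mulr_ge0 (ltW K0) X0).
(* The added 1 keeps the second constant positive when [G] is zero, where [W] vanishes. *)
exists c^-1, (W / c + 1), (2 * K * Q / c); split.
  split; first by rewrite invr_gt0.
    by rewrite ltr_wpDl// divr_ge0// ltW.
  by rewrite divr_gt0// mulr_gt0// mulr_gt0.
move=> F rho sigma beta2 eta dT T P theta0 g alpha dF dG cH lip [Fm Fm_le] rho0 Hlip
  b2 eta0 eta_le sig0 malpha alpha0 alpha_le mg g_le theta theta_prev _ var C_alpha ntilde.
have eta1 : eta <= 1 by move: eta_le; rewrite le_min => /andP[].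
have dGv x v : 'd (grad F) x v = mxv (hess F x) v by exact: diff_gradE.
have seg k w : grad F (theta k w) - grad F (theta_prev k w) =
    mxv (seg_hess_int F (theta_prev k w) (theta k w)) (theta k w - theta_prev k w).
  exact: (jacobian_seg (grad F) (hess F)).
split => //.
- by move=> k w; rewrite /ntilde seg.
- move=> k w.
  have -> : ntilde k w - grad F (theta k w)
       - alpha k w *: mxv (hess F (theta k w)) (theta k w - theta_prev k w) =
     alpha k w *: (grad F (theta k w) - grad F (theta_prev k w)
       - mxv (hess F (theta k w)) (theta k w - theta_prev k w)).
    by rewrite [RHS]scalerBr /ntilde [grad F _ + _]addrC addrK.
  rewrite norm2Z -mulrA; apply: ler_pM => //; first exact: norm2_ge0.
  exact: lipschitz_jacobian_remainder.
move=> n n1; have n0 : 0 < n%:R :> R by rewrite ltr0n.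
have Finf_le x : Finf F <= F x.
  by apply: ge_inf; [exists Fm => _ [y _ <-]; exact: Fm_le | exists x].
have mth k : coord_measurable (theta k).
  by have [] := coord_measurable_state beta1 beta2 delta eta theta0 g alpha del0 mg malpha k.
have mgr k : coord_measurable (fun w => grad F (theta k w)).
  move=> i; apply: (measurable_continuous_comp _ (fun x => grad F x ord0 i) (mth k)) => x.
  have gc : {for x, continuous (grad F)} by apply: differentiable_continuous; exact: dG.
  exact: (continuous_comp gc (@coord_continuous _ _ _ ord0 i _)).
(* The deterministic part of the bound in [sum_grad_le]. *)
pose B := (F theta0 - Finf F) / eta + n%:R * eta * W.
have B0 : 0 <= B.
  by rewrite addr_ge0// ?divr_ge0 ?subr_ge0 ?(ltW eta0)// mulr_ge0// mulr_ge0// ltW.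
have main := @integral_sum_le _ _ _ P n (fun k w => nsq (grad F (theta k w)))
  (fun k w => nsq (g k w - grad F (theta k w))) (B / c) (2 * K * Q / c) (sigma ^+ 2).
have {}main : (\sum_(k < n) \int[P]_w (norm2 (grad F (theta k w)) ^+ 2)%:E
    <= (B / c + 2 * K * Q / c * (n%:R * sigma ^+ 2))%:E)%E.
  under eq_bigr do under eq_integral do rewrite sqr_norm2.
  apply: main.
  - by rewrite divr_ge0// ltW.
  - by rewrite divr_ge0 ?(ltW c0)// mulr_ge0 ?(ltW Q0)// mulr_ge0// ltW.
  - by move=> k; exact: measurable_nsq.
  - by move=> k; apply: measurable_nsq; exact: coord_measurableB.
  - by move=> k w; exact: nsq_ge0.
  - by move=> k w; exact: nsq_ge0.
  - move=> k; under eq_integral do rewrite -sqr_norm2.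
    (* The conditional variance bound on the whole space is the unconditional one; [setT] belongs to
       the generated sigma-algebra as the complement of the empty set. *)
    apply: (le_trans (var k setT _)); last by rewrite probability_setT mule1.
    have [s0 sC _] := smallest_sigma_algebra (setT : set T) (\bigcup_(i in [set: 'I_d])
      preimage_set_system setT (fun w => theta k w ord0 i) measurable).
    by have := sC _ s0; rewrite setD0.
  - move=> w; rewrite mulrAC -mulrDl ler_pdivlMr// mulrC.
    exact: (@sum_grad_le _ _ beta1 beta2 delta eta theta0 (g^~ w) (alpha^~ w) G Ca).
apply: (le_trans (lee_wpmul2l _ main)); first by rewrite lee_fin invr_ge0 ltW.
rewrite -EFinM lee_fin.
have -> : n%:R^-1 * (B / c + 2 * K * Q / c * (n%:R * sigma ^+ 2)) =
  c^-1 * (F theta0 - Finf F) / (eta * n%:R) + W / c * eta + 2 * K * Q / c * sigma ^+ 2.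
  by rewrite /B; field; rewrite !gt_eqF.
(* Only slack remains: the nonnegative [G ^+ 2] in the first term and the added 1 in the second. *)
rewrite lerD2r lerD//.
  rewrite ler_wpM2r ?invr_ge0 ?mulr_ge0 ?(ltW eta0)// ler_wpM2l ?invr_ge0 ?(ltW c0)//.
  by rewrite lerDl sqr_ge0.
by rewrite ler_wpM2r ?(ltW eta0)// lerDl.
Qed.
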